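(* Let $k\ge0$ be an integer. As formal power series in $q$, $$\sum_{\mathbf a}q^{\sum_{i\ge0}ia_i}\,=\,\sum_{m_1,\dots,m_k=0}^\infty\frac{q^{Q(\mathbf m)}}{\prod_{l=1}^k(q)_{m_l}},$$ up to the following precise reading: for each degree the coefficients on both sides are finite and equal. Here the sum on the left runs over all sequences $\mathbf a=(a_i)_{i\in\mathbb Z_{\ge0}}$ of non-negative integers such that $a_i=0$ for all sufficiently large $i$ and $a_i+a_{i+1}+a_{i+2}\le k$ for all $i\ge0$; and $$Q(\mathbf m)=\frac12\sum_{l,l'=1}^kA_{l,l'}m_lm_{l'}-\frac12\sum_{l=1}^kA_{l,l}m_l .$$
   Context: $A_{l,l'}=2\min(l,l')+\max(l+l'-k,0)$ for $1\le l,l'\le k$; $\mathbf m=(m_1,\dots,m_k)$; $(q)_m=\prod_{i=1}^m(1-q^i)$. *)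

(* Defs.v *)
From HB Require Import structures.
From mathcomp Require Import all_boot all_order all_algebra.
From mathcomp Require Import zify.
From mathcomp Require Import boolp classical_sets functions.
From mathcomp Require Import cardinality fsbigop.

Set Implicit Arguments.
Unset Strict Implicit.
Unset Printing Implicit Defensive.

Import Order.TTheory GRing.Theory Num.Theory.

Local Open Scope classical_set_scope.
Local Open Scope ring_scope.

(* Formal power series over R, with the Cauchy product; the variable q is [fpsX]
   below. This is a record, not [nat -> R] itself, so that no pointwise product
   on functions can be inferred. *)
Record fps (R : Type) := Fps { fps_coef : nat -> R }.
Coercion fps_coef : fps >-> Funclass.

HB.instance Definition _ (R : Type) := gen_eqMixin (fps R).
HB.instance Definition _ (R : Type) := gen_choiceMixin (fps R).

Lemma fpsP (R : Type) (f g : fps R) : (forall n, f n = g n) -> f = g.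
Proof. by case: f g => [f] [g] /= fg; congr Fps; apply/funext. Qed.

Section FpsRing.
Variable R : comNzRingType.
Implicit Types f g h : fps R.

Definition fps_zero : fps R := Fps (fun=> 0).
Definition fps_one : fps R := Fps (fun n => (n == 0)%:R).
Definition fps_opp f : fps R := Fps (fun n => - f n).
Definition fps_add f g : fps R := Fps (fun n => f n + g n).
Definition fps_mul f g : fps R :=
  Fps (fun n => \sum_(i < n.+1) f i * g (n - i)%N).

Fact fps_addA : associative fps_add.
Proof. by move=> f g h; apply: fpsP => n /=; rewrite addrA. Qed.
Fact fps_addC : commutative fps_add.
Proof. by move=> f g; apply: fpsP => n /=; rewrite addrC. Qed.
Fact fps_add0 : left_id fps_zero fps_add.
Proof. by move=> f; apply: fpsP => n /=; rewrite add0r. Qed.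
Fact fps_addN : left_inverse fps_zero fps_opp fps_add.
Proof. by move=> f; apply: fpsP => n /=; rewrite addNr. Qed.

HB.instance Definition _ :=
  GRing.isZmodule.Build (fps R) fps_addA fps_addC fps_add0 fps_addN.

Definition fps_trunc N f : {poly R} := \poly_(i < N.+1) f i.

Lemma coef_fps_trunc N f n : (n <= N)%N -> (fps_trunc N f)`_n = f n.
Proof. by move=> nN; rewrite coef_poly ltnS nN. Qed.

Lemma fps_mul_trunc N f g n : (n <= N)%N ->
  fps_mul f g n = (fps_trunc N f * fps_trunc N g)`_n.
Proof.
move=> nN; rewrite coefM; apply: eq_bigr => -[i /= ni] _.
rewrite !coef_fps_trunc//; lia.
Qed.

Fact fps_mulA : associative fps_mul.
Proof.
move=> f g h; apply: fpsP => n; rewrite !(@fps_mul_trunc n)//.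
transitivity (fps_trunc n f * fps_trunc n g * fps_trunc n h)`_n.
  rewrite -mulrA !coefM; apply: eq_bigr => -[i /= ni] _; congr (_ * _).
  by rewrite coef_fps_trunc ?leq_subr// (@fps_mul_trunc n) ?leq_subr.
rewrite !coefM; apply: eq_bigr => -[i /= ni] _; congr (_ * _).
by rewrite coef_fps_trunc// (@fps_mul_trunc n).
Qed.

Fact fps_mulC : commutative fps_mul.
Proof. by move=> f g; apply: fpsP => n; rewrite !(@fps_mul_trunc n)// mulrC. Qed.

Fact fps_mul1 : left_id fps_one fps_mul.
Proof.
move=> f; apply: fpsP => n /=.
by rewrite big_ord_recl /= mul1r subn0 big1 ?addr0// => i _; rewrite mul0r.
Qed.

Fact fps_mulDl : left_distributive fps_mul fps_add.
Proof.
move=> f g h; apply: fpsP => n /=; rewrite -big_split /=.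
by apply: eq_bigr => i _; rewrite mulrDl.
Qed.

Fact fps_one_neq0 : fps_one != 0.
Proof. by apply/eqP => /(congr1 (fun h : fps R => h 0%N)) /eqP; rewrite /= oner_eq0. Qed.

HB.instance Definition _ := GRing.Zmodule_isComNzRing.Build (fps R)
  fps_mulA fps_mulC fps_mul1 fps_mulDl fps_one_neq0.

Definition fpsX : fps R := Fps (fun n => (n == 1)%:R).

Lemma fps_coef0 n : (0 : fps R) n = 0. Proof. by []. Qed.
Lemma fps_coef1 n : (1 : fps R) n = (n == 0)%:R. Proof. by []. Qed.
Lemma fps_coefN f n : (- f) n = - f n. Proof. by []. Qed.
Lemma fps_coefD f g n : (f + g) n = f n + g n. Proof. by []. Qed.
Lemma fps_coefM f g n : (f * g) n = \sum_(i < n.+1) f i * g (n - i)%N.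
Proof. by []. Qed.

Lemma fps_coefXn d n : (fpsX ^+ d) n = (n == d)%:R.
Proof.
elim: d n => [|d IHd] n; first by rewrite expr0.
rewrite exprS fps_coefM big_ord_recl mul0r add0r; case: n => [|n].
  by rewrite big_ord0.
rewrite big_ord_recl mul1r big1 ?addr0; last by move=> i _; rewrite mul0r.
by rewrite IHd subSS subn0.
Qed.

End FpsRing.

Section FpsUnitRing.
Variable R : comUnitRingType.
Implicit Types f g : fps R.

Fixpoint fps_inv_seq f n : seq R :=
  if n is n'.+1 then
    let s := fps_inv_seq f n' in
    rcons s ((f 0%N)^-1 * ((n' == 0)%:R - \sum_(i < n') s`_i * f (n' - i)%N))
  else [::].

Definition fps_unit : pred (fps R) := fun f => f 0%N \is a GRing.unit.

Definition fps_inv f : fps R :=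
  if fps_unit f then Fps (fun n => (fps_inv_seq f n.+1)`_n) else f.

Lemma size_fps_inv_seq f n : size (fps_inv_seq f n) = n.
Proof. by elim: n => //= n IHn; rewrite size_rcons IHn. Qed.

Lemma nth_fps_inv_seq f n i : (i < n)%N ->
  (fps_inv_seq f n)`_i = (fps_inv_seq f i.+1)`_i.
Proof.
elim: n => // n IHn; rewrite ltnS leq_eqVlt => /predU1P[->//|ltin].
by rewrite [LHS]nth_rcons size_fps_inv_seq ltin IHn.
Qed.

Fact fps_mulVx : {in fps_unit, left_inverse 1 fps_inv *%R}.
Proof.
move=> f Uf; apply: fpsP => n.
rewrite fps_coefM fps_coef1 /fps_inv ifT// big_ord_recr /= subnn.
rewrite nth_rcons size_fps_inv_seq ltnn eqxx mulrAC mulVr// mul1r.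
rewrite addrCA [X in _ + X](_ : _ = 0) ?addr0// -sumrB big1// => -[i /= ltin] _.
by rewrite (nth_fps_inv_seq f ltin) subrr.
Qed.

Fact fps_unitP f g : g * f = 1 -> fps_unit f.
Proof.
move=> /(congr1 (fun h : fps R => h 0%N)); rewrite fps_coefM big_ord1.
by move=> gf; apply/unitrPr; exists (g 0%N); rewrite mulrC.
Qed.

Fact fps_inv_out : {in [predC fps_unit], fps_inv =1 id}.
Proof. by move=> f; rewrite inE /fps_inv; case: ifP => // fU /negP[]. Qed.

HB.instance Definition _ := GRing.ComNzRing_hasMulInverse.Build (fps R)
  fps_mulVx fps_unitP fps_inv_out.

Lemma fps_unitE f : (f \is a GRing.unit) = (f 0%N \is a GRing.unit).
Proof. by []. Qed.

End FpsUnitRing.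

(* Infinite sums are taken coefficientwise. [fps_sum] is meaningful only for a
   summable family: otherwise a coefficient to which infinitely many members
   contribute is set to 0. *)
Definition fps_summable (R : comNzRingType) (I : choiceType) (D : set I)
    (F : I -> fps R) : Prop :=
  forall n, finite_set [set i | D i /\ F i n != 0].

Definition fps_sum (R : comNzRingType) (I : choiceType) (D : set I)
    (F : I -> fps R) : fps R :=
  Fps (fun n => \sum_(i \in D) F i n).

Definition qpochhammer (m : nat) : fps int :=
  \prod_(1 <= i < m.+1) (1 - fpsX int ^+ i).

Lemma qpochhammer_unit m : qpochhammer m \is a GRing.unit.
Proof.
rewrite /qpochhammer big_seq; apply: rpred_prod => i.
rewrite mem_index_iota => /andP[i_gt0 _].
by rewrite fps_unitE fps_coefD fps_coefN fps_coefXn eq_sym (gtn_eqF i_gt0).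
Qed.

Definition admissible (k : nat) : set (nat -> nat) :=
  [set a | (exists N, forall i, (N <= i)%N -> a i = 0%N) /\
           forall i, (a i + a i.+1 + a i.+2 <= k)%N].

(* Sum over i of i * a_i; it has finite support when [a] is eventually zero. *)
Definition degree (a : nat -> nat) : nat :=
  \big[addn/0%N]_(i \in [set: nat]) (i * a i)%N.

(* By truncated subtraction, [l + l' - k] is max(l + l' - k, 0). *)
Definition matA (k l l' : nat) : nat := (2 * minn l l' + (l + l' - k))%N.

(* The index l : 'I_k stands for l + 1 in {1, ..., k}, so [m l] is m_(l+1).
   Subtraction and halving are exact here, see [quadQE]. *)
Definition quadQ (k : nat) (m : {ffun 'I_k -> nat}) : nat :=
  (\sum_(l < k) \sum_(l' < k) matA k l.+1 l'.+1 * m l * m l'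
   - \sum_(l < k) matA k l.+1 l.+1 * m l)./2%N.

Lemma matAC k l l' : matA k l l' = matA k l' l.
Proof. by rewrite /matA minnC addnC [(l + l')%N]addnC addnC. Qed.

Lemma sum_symm_diag n (F : 'I_n -> 'I_n -> nat) :
    (forall i j, F i j = F j i) ->
  (\sum_(i < n) \sum_(j < n) F i j =
   \sum_(i < n) F i i + 2 * \sum_(i < n) \sum_(j < n | (i < j)%N) F i j)%N.
Proof.
move=> FC.
have -> : (\sum_(i < n) \sum_(j < n) F i j = \sum_(i < n) (F i i +
    (\sum_(j < n | (i < j)%N) F i j + \sum_(j < n | (j < i)%N) F i j)))%N.
  apply: eq_bigr => i _; rewrite (bigD1 i)//=; congr addn.
  rewrite (bigID (fun j : 'I_n => (i < j)%N))/=; congr addn; apply: eq_bigl => j;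
  rewrite -val_eqE /=; lia.
rewrite !big_split /= mul2n -addnn; congr (_ + (_ + _))%N.
rewrite (exchange_big_dep predT)//=.
by apply: eq_bigr => i _; apply: eq_bigr => j _; rewrite FC.
Qed.

Lemma quadQE k (m : {ffun 'I_k -> nat}) :
  (quadQ m)%:R =
  2%:R^-1 * (\sum_(l < k) \sum_(l' < k)
               (matA k l.+1 l'.+1)%:R * (m l)%:R * (m l')%:R)
  - 2%:R^-1 * (\sum_(l < k) (matA k l.+1 l.+1)%:R * (m l)%:R) :> rat.
Proof.
set S := (\sum_(l < k) \sum_(l' < k) matA k l.+1 l'.+1 * m l * m l')%N.
set T := (\sum_(l < k) matA k l.+1 l.+1 * m l)%N.
have [c ST] : exists c, (S = T + c.*2)%N.
  exists (\sum_(l < k) matA k l.+1 l.+1 * 'C(m l, 2) +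
    \sum_(i < k) \sum_(j < k | (i < j)%N) matA k i.+1 j.+1 * m i * m j)%N.
  rewrite /S sum_symm_diag; last by move=> i j; rewrite matAC; lia.
  rewrite doubleD addnA mul2n; congr addn.
  rewrite -mul2n big_distrr -big_split /=; apply: eq_bigr => l _.
  rewrite bin2 mulnCA -[RHS]mulnDr -mulnA; congr muln.
  by rewrite mul2n halfK oddM; case: (m l) => [|n] //=; rewrite andNb; lia.
have -> : \sum_(l < k) \sum_(l' < k)
    (matA k l.+1 l'.+1)%:R * (m l)%:R * (m l')%:R = S%:R :> rat.
  rewrite /S natr_sum; apply: eq_bigr => l _; rewrite natr_sum.
  by apply: eq_bigr => l' _; rewrite !natrM.
have -> : \sum_(l < k) (matA k l.+1 l.+1)%:R * (m l)%:R = T%:R :> rat.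
  by rewrite /T natr_sum; apply: eq_bigr => l _; rewrite natrM.
have -> : quadQ m = c by rewrite /quadQ -/S -/T ST addnC addnK doubleK.
by rewrite -mulrBr ST natrD addrC addKr -mul2n natrM mulKf.
Qed.

(* Main.v *)
Require Import Defs.
From mathcomp Require Import all_boot all_order all_algebra.
From mathcomp Require Import boolp classical_sets functions cardinality fsbigop.
From mathcomp Require Import zify.
Import GRing.Theory.

(** The configurations are sorted into classes indexed by m, and the series of
a class is found from a recursion that adds one particle to m.

For a capacity t, the load of a configuration f is the part of f that is packed
greedily from the left under the following limits: at most t on two adjacent
sites, and at most t + b_i on the sites i - 2, i - 1, i, where b_i is the room
k - (f_(i-1) + f_i + f_(i+1)) left around i. The slide of capacity t keeps the
load in place and moves the rest of f one site to the left. When the first site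
holds at most t, no mass falls off the line, and the slide is reversible: the
load of the reflected image is the reflected load ([rev_is_load]), so the same
slide performed on the mirror image undoes it ([slideK]).

Let stat q f be the mass of the load of capacity q. Every slide preserves every
stat q ([stat_slide]). This is a min-plus duality: the mass of a greedy load
equals the least cost of a tiling of the line by tiles of lengths 1, 2 and 3,
and [key_invariantP] compares the loads of f with the tilings of its slide. The
numbers stat q f for q at most k determine, and are determined by, the numbers
m_l of particles of size l through stat q f = sum_l min(q, l) m_l
([content_exists], [content_unique]).

Let l be at least the largest size occurring in m, and add one particle of size
l to m. The configurations of the new class whose first site holds less than l
are mapped by the slide of capacity l - 1 onto the whole new class; the slide
lowers the energy by the mass outside the load, which is m_l + 1
([slide_low_bij], [energy_low]). In the others the first two sites hold l and
0; deleting these sites and sliding with capacity k - l is a bijection onto the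
class of m, and the energy drops by a constant w ([strip_bij], [energy_high]).
Hence the series S satisfy

  (1 - X^(m_l + 1)) S(m + e_l) = X^w S(m),

and since w = Q(m + e_l) - Q(m) ([quadQ_add]), the series S(m) is X^Q(m) /
prod_l (q)_(m_l) ([characterE]). Summing over m proves the theorem.

Configurations are functions that vanish on the indices 0 to 5: the site i of
the sequence a has index i + 6. With these empty sites every window of
consecutive sites has the same description, including the windows at the edge. *)

(** * Loads *)

Section Carrier.
Local Open Scope nat_scope.
Variable k : nat.
Implicit Types (f g : nat -> nat) (t q p M N : nat).

Definition bounded f := forall i, f i + f i.+1 + f i.+2 <= k.

Definition load_step t (u0 u1 l c r : nat) :=
  minn c (minn (t - u1) (t + k - (l + c + r) - u0 - u1)).

Fixpoint load_pair t f n : nat * nat :=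
  if n is n'.+1 then
    let: (u0, u1) := load_pair t f n' in
    (u1, load_step t u0 u1 (f n'.+1) (f n'.+2) (f n'.+3))
  else (0, 0).

Definition load t f n := (load_pair t f n).1.

(** The greedy choice of the load u2 at a site, given the loads u0, u1 of the
two sites before it and the contents l, c, r of the site and its neighbours:
the three limits hold and one of them is attained. In this form the rule can be
read from right to left as well. *)
Definition load_at t (u0 u1 u2 l c r : nat) : Prop :=
  u2 <= c /\ u1 + u2 <= t /\ u0 + u1 + u2 + (l + c + r) <= t + k /\
  (u2 = c \/ u1 + u2 = t \/ u0 + u1 + u2 + (l + c + r) = t + k).

Definition is_load t f (u : nat -> nat) :=
  u 0 = 0 /\ u 1 = 0 /\
  forall i, load_at t (u i) (u i.+1) (u i.+2) (f i.+1) (f i.+2) (f i.+3).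

Lemma load_is_load t f : bounded f -> is_load t f (load t f).
Proof.
move=> bf; split=> //; split=> // i.
have e2 n : load t f n.+1 = (load_pair t f n).2.
  by rewrite /load /=; case: (load_pair t f n).
have e3 n : load t f n.+2 = load_step t (load t f n) (load t f n.+1)
    (f n.+1) (f n.+2) (f n.+3).
  by rewrite e2 [in RHS]e2 /load /=; case: (load_pair t f n).
have le n : load t f n + load t f n.+1 <= t.
  elim: n => [//|n IHn]; rewrite e3 /load_step; lia.
have := le i; have := bf i.+1; rewrite e3 /load_step /load_at; lia.
Qed.

Lemma is_load_uniq t f u v : is_load t f u -> is_load t f v -> u =1 v.
Proof.
move=> [u0 [u1 Hu]] [v0 [v1 Hv]].
suff H n : u n = v n /\ u n.+1 = v n.+1 by move=> n; case: (H n).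
elim: n => [|n [IH0 IH1]]; first by rewrite u0 u1 v0 v1.
split=> //; have := Hu n; have := Hv n; rewrite /load_at; lia.
Qed.

(** The load stays in place and the excess f - u moves one site to the left. *)
Definition push f (u : nat -> nat) i := u i + (f i.+1 - u i.+1).

(** The load rule for the reflected configuration: a is the configuration after
the push and w is its load, built from right to left. *)
Definition mirror_load_at t (a0 a1 a2 w1 w2 w3 : nat) : Prop :=
  load_at t w3 w2 w1 a2 a1 a0.

Section Windows.
Variables (t : nat) (f u : nat -> nat).
Hypothesis (bf : bounded f) (Hu : is_load t f u).

Lemma load_le i : u i <= f i.
Proof.
have [u0 [u1 H]] := Hu.
by case: i => [|[|i]]; rewrite ?u0 ?u1//; case: (H i).
Qed.

Lemma load_pair_le i : u i + u i.+1 <= t.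
Proof.
have [u0 [u1 H]] := Hu.
by case: i => [|i]; [rewrite u0 u1 | case: (H i) => _ []].
Qed.

(** An overfull triple after the push would receive excess from its right
neighbour; there the load has reached one of the limits t or t + b, and each of
them leaves enough room. *)
Lemma push_bounded : push f u 0 = 0 -> push f u 1 = 0 -> bounded (push f u).
Proof.
move=> a0 a1 i.
have [u0 [u1 H]] := Hu.
have le := load_le.
case: i => [|i].
  rewrite a0 a1 /push.
  have := H 0; have := H 1; have := bf 2; have := bf 1; have := le 3.
  have := load_pair_le 2.
  rewrite /load_at u0 u1; lia.
have := H i; have := H i.+1; have := H i.+2.
have := bf i; have := bf i.+1; have := bf i.+2; have := bf i.+3.
have := le i; have := le i.+1; have := le i.+2; have := le i.+3.
have := le i.+4.
have := load_pair_le i; have := load_pair_le i.+1.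
rewrite /load_at /push; lia.
Qed.

(** If site i still holds more than its load after the push, then excess came
from site i + 1, so the load attained one of its limits there; that same limit
is attained by the reflected rule. *)
Lemma push_mirror i :
  mirror_load_at t (push f u i) (push f u i.+1) (push f u i.+2)
    (u i.+1) (u i.+2) (u i.+3).
Proof.
have [u0 [u1 H]] := Hu.
have le := load_le.
have := H i; have := H i.+1.
have := le i; have := le i.+1; have := le i.+2; have := le i.+3.
rewrite /mirror_load_at /load_at /push; lia.
Qed.

End Windows.

(** * Comparison of loads with tilings of the slid configuration *)

(** X is any sequence obeying the limits that the partial sums of the load of
capacity q obey on f. Y is the cost of a tiling of the pushed configuration: a
site costs its content, a pair costs q, and a triple costs q plus the room
around its left end, as for loads of the mirror image. *)
Section KeyInequality.
Variables (t q : nat) (f u X Y : nat -> nat).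
Hypothesis bf : bounded f.
Hypothesis f0 : forall i, i < 6 -> f i = 0.
Hypothesis Hu : is_load t f u.
Hypothesis X0 : forall i, i < 6 -> X i = 0.
Hypothesis HX : forall i, X i.+3 <= X i.+2 + f i.+3 /\ X i.+3 <= X i.+1 + q /\
  X i.+3 + (f i.+2 + f i.+3 + f i.+4) <= X i + q + k.
Hypothesis HY : forall i, Y i.+3 = Y i.+2 + push f u i.+3 \/
  Y i.+3 = Y i.+1 + q \/
  Y i.+3 + (push f u i + push f u i.+1 + push f u i.+2) = Y i + q + k.

(** A strengthening of X j <= Y j that survives an induction over three
consecutive values of j. The shift in the first clause comes from the push: on
the sites up to j the pushed configuration has the mass of f up to site j + 1,
less the load of site j + 1. The two disjunctions are the additional information
needed when the tiling ends with a triple. *)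
Definition key_invariant j : Prop :=
  (X j.+1 <= Y j + u j.+1) /\ (X j.+2 <= Y j + q) /\ (X j <= Y j) /\
  (X j.+1 + (f j + f j.+1 + f j.+2) <= Y j + k + (f j - u j) \/
   X j.+2 + u j + (f j.+1 + f j.+2 + f j.+3) <= Y j + q + k) /\
  (X j.+2 + u j + (f j.+1 + f j.+2 + f j.+3) <= Y j + k + t \/
   X j.+3 + f j.+4 + u j + (f j.+1 + f j.+2 + f j.+3) <= Y j + q + k + t).

Lemma key_step j : key_invariant j -> key_invariant j.+1 -> key_invariant j.+2 ->
  key_invariant j.+3.
Proof.
have le := load_le _ _ _ Hu.
have [u0 [u1 H]] := Hu.
have hx1 := HX j; have hx2 := HX j.+1; have hx3 := HX j.+2.
have hx4 := HX j.+3.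
have h1 := H j; have h2 := H j.+1; have h3 := H j.+2.
have l0 := le j; have l1 := le j.+1; have l2 := le j.+2.
have l3 := le j.+3; have l4 := le j.+4.
move: (HY j) h1 h2 h3.
rewrite /key_invariant /load_at /push.
move=> y h1 h2 h3.
case=> [A0 [B0 [C0 [D0 G0]]]] [A1 [B1 [C1 _]]] [A2 [_ [C2 _]]].
have hA : X j.+4 <= Y j.+3 + u j.+4.
  clear hx4; case: y => [y|[y|y]].
  - clear D0 G0; lia.
  - clear D0 G0; lia.
  - move: h3 => [h30 [h31 [h32 [h3|[h3|h3]]]]].
    + clear G0; lia.
    + clear D0; lia.
    + clear D0 G0; lia.
have hC : X j.+3 <= Y j.+3.
  clear hx4 hA h3; case: y => [y|[y|y]].
  - clear D0 G0; lia.
  - clear D0 G0; lia.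
  - move: h2 => [h20 [h21 [h22 [h2|[h2|h2]]]]].
    + clear G0; lia.
    + clear D0 G0; lia.
    + clear D0 G0; lia.
split=> //; split; first lia.
split=> //; split.
  clear hA hC G0; case: y => [y|[y|y]]; last case: D0 => D0; lia.
clear hA hC D0.
have hx5 := HX j.+4.
case: y => [y|[y|y]]; last case: G0 => G0; lia.
Qed.

Lemma key_invariantP j : key_invariant j.
Proof.
suff I n : [/\ key_invariant n, key_invariant n.+1 & key_invariant n.+2].
  by case: (I j).
elim: n => [|n [I0 I1 I2]]; last by split=> //; apply: key_step.
have b4 := bf 4; have b5 := bf 5; have b6 := bf 6.
have [u0 [u1 H]] := Hu.
have [fz0 fz1 fz2] := And3 (f0 0 isT) (f0 1 isT) (f0 2 isT).
have [fz3 fz4 fz5] := And3 (f0 3 isT) (f0 4 isT) (f0 5 isT).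
have le := load_le _ _ _ Hu.
have := le 2; have := le 3.
by split; rewrite /key_invariant !X0 //; lia.
Qed.

End KeyInequality.
(** * Configurations and their reflection *)

(** M is the width of a frame for the reflection i |-> M - i: there are six
empty sites at the right end as well, so that the mirror image has the same
form. *)
Definition config M f := (forall i, i < 6 \/ M < i + 6 -> f i = 0) /\ bounded f.

Definition rev M f i := if i <= M then f (M - i) else 0.

Definition total f := \big[addn/0%N]_(i \in [set: nat]) f i.

Lemma totalE M f : (forall i, M <= i -> f i = 0) -> total f = \sum_(i < M) f i.
Proof.
move=> fM; rewrite fsbig_ord; apply/esym/fsbig_widen => // i [_ /= iM].
by apply: fM; rewrite leqNgt; apply/negP.
Qed.

Lemma configW M N f : M <= N -> config M f -> config N f.
Proof. by move=> MN [f0 bf]; split=> // i hi; apply: f0; lia. Qed.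

Lemma config_bounded M f : config M f -> bounded f. Proof. by case. Qed.

Lemma revK M f : config M f -> rev M (rev M f) = f.
Proof.
move=> [f0 _]; apply/funext => i; rewrite /rev.
case: (leqP i M) => iM; last by rewrite f0 //; lia.
by rewrite leq_subr subKn.
Qed.

Lemma rev_config M f : config M f -> config M (rev M f).
Proof.
move=> [f0 bf].
have r0 i : i < 6 \/ M < i + 6 -> rev M f i = 0.
  by rewrite /rev => hi; case: leqP => // iM; apply: f0; lia.
split=> // i; case: (leqP i.+2 M) => [i2|i2]; last by rewrite !r0; lia.
rewrite /rev.
have := bf (M - i.+2).
have -> : (M - i.+2).+2 = M - i by lia.
have -> : (M - i.+2).+1 = M - i.+1 by lia.
have -> : i.+1 <= M by lia.
have -> : i <= M by lia.
rewrite i2; lia.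
Qed.

Section Reflection.
Variables (t M : nat) (f u : nat -> nat).
Hypotheses (cf : config M f) (ca : config M (push f u)) (Hu : is_load t f u).

Lemma load_config0 i : i < 6 \/ M < i + 6 -> u i = 0.
Proof. by move=> /(proj1 cf); have := load_le _ _ _ Hu i; lia. Qed.

(** Reflection turns the pushed configuration into one whose load is the
reflected load of the original. *)
Lemma rev_is_load : is_load t (rev M (push f u)) (rev M u).
Proof.
have uz := load_config0; have az := proj1 ca.
have rz i : i < 2 \/ M < i + 3 -> rev M u i = 0.
  by move=> hi; rewrite /rev; case: leqP => // iM; apply: uz; lia.
have raz i : i < 2 \/ M < i + 3 -> rev M (push f u) i = 0.
  by move=> hi; rewrite /rev; case: leqP => // iM; apply: az; lia.
split; [by apply: rz; lia | split; first by apply: rz; lia].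
move=> i; case: (leqP i.+3 M) => iM; last first.
  rewrite !rz ?raz /load_at; lia.
have := push_mirror _ _ _ Hu (M - i.+3); rewrite /mirror_load_at /rev.
have -> : (M - i.+3).+3 = M - i by lia.
have -> : (M - i.+3).+2 = M - i.+1 by lia.
have -> : (M - i.+3).+1 = M - i.+2 by lia.
have [-> -> -> ->] : [/\ i <= M, i < M, i.+1 < M & i.+2 < M] by split; lia.
by [].
Qed.

Lemma rev_push : push (rev M (push f u)) (rev M u) = rev M f.
Proof.
apply/funext => i; rewrite /push /rev.
have le := load_le _ _ _ Hu.
case: (leqP i M) => iM; last by case: leqP => //; lia.
case: (leqP i.+1 M) => i1; last first.
  have -> : M - i = 0 by lia.
  have [u0 _] := Hu; rewrite u0 (proj1 cf 0) //; lia.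
have -> : M - i = (M - i.+1).+1 by lia.
have := le (M - i.+1); have := le (M - i.+1).+1; lia.
Qed.

End Reflection.

(** * Masses of loads under slides *)

Section Stat.

(** Three consecutive values of the least cost of a tiling by tiles of lengths
1, 2 and 3, with the costs that bound the loads of the mirror image. *)
Fixpoint tiling q (f : nat -> nat) n : nat * nat * nat :=
  if n is n'.+1 then
    let: (y0, y1, y2) := tiling q f n' in
    (y1, y2, minn (y2 + f n'.+3)
               (minn (y1 + q) (y0 + q + (k - (f n' + f n'.+1 + f n'.+2)))))
  else (0, 0, 0).

Definition stat q f := total (load q f).

Variables (t q M : nat) (f u : nat -> nat).
Hypotheses (cf : config M f) (ca : config M (push f u)) (Hu : is_load t f u).

(** The load w of the mirror image is greedy, so at every site one of its
limits is attained; read from left to right this yields, from each cut point,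
one tile whose cost is exactly the mass of w on it. Starting with a cut at the
right end, where [key_invariantP] bounds the load of f by a tiling from the
left, the cut is moved to the left end, where only the load w remains. *)
Lemma stat_le_rev : stat q f <= stat q (rev M (push f u)).
Proof.
set a := push f u.
have ca' : config M a := ca.
have Hx := load_is_load q f (config_bounded M f cf).
have cr := rev_config M a ca'.
have Hw := load_is_load q (rev M a) (config_bounded _ _ cr).
set x := load q f in Hx *.
set w := load q (rev M a) in Hw *.
have xz := load_config0 q M f x cf Hx.
have wz := load_config0 q M (rev M a) w cr Hw.
rewrite /stat -/x -/w !(totalE M.+1);
  try by move=> i hi; rewrite ?xz ?wz //; lia.
pose X n := \sum_(i < n.+1) x i.
pose Y n := (tiling q a n).1.1.
have Y1 n : Y n.+1 = (tiling q a n).1.2.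
  by rewrite /Y /=; case: (tiling q a n) => [[]].
have Y2 n : Y n.+2 = (tiling q a n).2.
  by rewrite Y1 /=; case: (tiling q a n) => [[]].
have Y3 n : Y n.+3 = minn (Y n.+2 + a n.+3)
    (minn (Y n.+1 + q) (Y n + q + (k - (a n + a n.+1 + a n.+2)))).
  by rewrite Y2 [in RHS]Y2 Y1 /Y /=; case: (tiling q a n) => [[]].
have XS n : X n.+1 = X n + x n.+1 by rewrite /X big_ord_recr.
have X0 i : i < 6 -> X i = 0.
  by move=> hi; rewrite /X big1 // => j _; apply: xz; have := ltn_ord j; lia.
have ba := config_bounded _ _ ca'.
have XY n : X n <= Y n.
  have [] // := key_invariantP t q f u X Y (config_bounded _ _ cf) _ Hu X0 _ _ n.
  - by move=> i hi; apply: (proj1 cf); left.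
  - move=> i; have [_ [_ H]] := Hx; have := H i.+1.
    by rewrite /load_at !XS; lia.
  - by move=> i; rewrite Y3 -/a; have := ba i; lia.
  - by move=> _ [_ []].
have [Yz0 Yz1 Yz2] : [/\ Y 0 = 0, Y 1 = 0 & Y 2 = 0] by [].
have {}Y1 n : Y n.+1 <= Y n + a n.+1.
  case: n => [|[|n]]; rewrite ?Y3; lia.
have {}Y2 n : Y n.+2 <= Y n + q.
  case: n => [|n]; rewrite ?Y3; lia.
pose Z n := \sum_(i < M.+1 | n <= i) rev M w i.
pose z := rev M w.
have ZS n : n <= M -> Z n = z n + Z n.+1.
  move=> nM; rewrite /Z (bigD1 (Ordinal (nM : n < M.+1))) //=.
  congr addn; apply: eq_bigl => i; rewrite -val_eqE /=; lia.
have Zz n : M < n -> Z n = 0.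
  by move=> nM; rewrite /Z big1 // => i; have := ltn_ord i; lia.
have ZM : forall n, Z n = z n + Z n.+1.
  move=> n; case: (leqP n M) => [/ZS //|nM].
  by rewrite !Zz ?(leqW nM) // /z /rev leqNgt nM.
have Xmono m n : m <= n -> X m <= X n.
  elim: n => [|n IHn]; first by rewrite leqn0 => /eqP ->.
  by rewrite leq_eqVlt => /predU1P[->//|/IHn]; rewrite XS; lia.
(* a cut after site i: a tiling of the sites up to i, and the loads w of the
   sites from i + 1 on; three consecutive cuts are needed to move by a triple *)
have cut n : forall d i, i + d = n.+2 -> X n <= Y i + Z i.+1 /\
    X n <= Y i.+1 + Z i.+2 /\ X n <= Y i.+2 + Z i.+3.
  elim=> [|d IHd] i.
    rewrite addn0 => ->.
    have := XY n.+2; have := XY n.+3; have := XY n.+4.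
    have := Xmono n n.+2; have := Xmono n n.+3; have := Xmono n n.+4; lia.
  move=> hi; have [] := IHd i.+1; first lia.
  move=> h1 [h2 h3]; split; last by [].
  have Hz : mirror_load_at q (a i) (a i.+1) (a i.+2) (z i.+1) (z i.+2) (z i.+3).
    rewrite /mirror_load_at.
    case: (leqP i.+3 M) => iM.
      have [_ [_ H]] := Hw; have := H (M - i.+3).
      rewrite /z /rev.
      have -> : (M - i.+3).+3 = M - i by lia.
      have -> : (M - i.+3).+2 = M - i.+1 by lia.
      have -> : (M - i.+3).+1 = M - i.+2 by lia.
      rewrite !leq_subr !subKn; try lia.
      by have [-> -> ->] : [/\ i < M, i.+1 < M & i.+2 < M] by split; lia.
    have zz j : i < j -> z j = 0.
      by move=> ij; rewrite /z /rev; case: leqP => // jM; apply: wz; lia.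
    have az j : i <= j -> a j = 0 by move=> ij; apply: (proj1 ca'); lia.
    have [-> -> ->] : [/\ z i.+1 = 0, z i.+2 = 0 & z i.+3 = 0].
      by split; apply: zz; lia.
    have [-> -> ->] : [/\ a i = 0, a i.+1 = 0 & a i.+2 = 0].
      by split; apply: az; lia.
    by rewrite /load_at; lia.
  have := ZM i.+1; have := ZM i.+2; have := ZM i.+3.
  move: Hz; have := Y1 i; have := Y2 i; have := Y3 i; have := ba i.
  rewrite /mirror_load_at /load_at; lia.
have [h _] := cut M M.+2 0 (erefl _).
apply: (leq_trans (h : X M <= _)); rewrite /Y add0n /Z.
have -> : \sum_(i < M.+1) w i = \sum_(i < M.+1) rev M w i.
  rewrite (reindex_inj rev_ord_inj) /=; apply: eq_bigr => i _.
  rewrite /rev subSS; have := ltn_ord i; rewrite ltnS => hi.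
  by rewrite hi.
by rewrite [leqRHS](bigID (fun i : 'I__ => 0 < i)) /= leq_addr.
Qed.

End Stat.

(** * Slides *)

Definition slide t f := push f (load t f).

Section ConfigTheory.
Variables (M : nat) (f : nat -> nat).
Hypothesis cf : config M f.

Lemma load_full : load k f = f.
Proof.
have [f0 bf] := cf.
apply/funext; apply: (is_load_uniq k f); first exact: load_is_load.
split; first by apply: f0; left.
split; first by apply: f0; left.
by move=> i; have := bf i; have := bf i.+1; rewrite /load_at; lia.
Qed.

Lemma slide_full : slide k f = f.
Proof.
by rewrite /slide load_full; apply/funext => i; rewrite /push subnn addn0.
Qed.

Lemma load_leq t i : load t f i <= f i.
Proof. exact: load_le _ _ _ (load_is_load t f (proj2 cf)) i. Qed.

Lemma load0 t i : i < 6 \/ M < i + 6 -> load t f i = 0.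
Proof. by move=> /(proj1 cf); have := load_leq t i; lia. Qed.

Lemma statE q : stat q f = \sum_(i < M) load q f i.
Proof. by apply: totalE => i hi; apply: load0; lia. Qed.

Lemma total_config : total f = \sum_(i < M) f i.
Proof. by apply: totalE => i hi; apply: (proj1 cf); lia. Qed.

Lemma stat_full : stat k f = total f.
Proof. by rewrite /stat load_full. Qed.

Lemma stat_le_total q : stat q f <= total f.
Proof.
by rewrite statE total_config; apply: leq_sum => i _; apply: load_leq.
Qed.

End ConfigTheory.

(** The slide of the full capacity k moves nothing, so the comparison of f with
the mirror image of its slide becomes a comparison of f with its mirror image. *)
Lemma stat_rev_le q M f : config M f -> stat q f <= stat q (rev M f).
Proof.
move=> cf; have sf := slide_full M f cf.
have := stat_le_rev k q M f (load k f) cf; rewrite -/(slide k f) sf; apply=> //.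
exact: load_is_load _ _ (proj2 cf).
Qed.

Lemma stat_rev q M f : config M f -> stat q (rev M f) = stat q f.
Proof.
move=> cf; have := stat_rev_le q M f cf.
have := stat_rev_le q M _ (rev_config M f cf); rewrite (revK M f cf); lia.
Qed.

(** Under the hypothesis on the first site nothing is pushed off the line. *)
Section Slide.
Variables (t M : nat) (f : nat -> nat).
Hypotheses (cf : config M f) (ft : f 6 <= t).

Lemma load6 : load t f 6 = f 6.
Proof.
have [f0 bf] := cf.
have [_ [_ H]] := load_is_load t f bf.
have := H 4; have := bf 6; have := f0 5 (or_introl isT).
have := load0 M f cf t 4 (or_introl isT).
have := load0 M f cf t 5 (or_introl isT).
rewrite /load_at; lia.
Qed.

Lemma slide_config : config M (slide t f).
Proof.
have [f0 bf] := cf.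
have z i : i < 6 \/ M < i + 6 -> slide t f i = 0.
  move=> hi; rewrite /slide /push (load0 M f cf t i hi) add0n.
  case: (ltngtP i 5) => i5; last by rewrite i5 load6 subnn.
    by rewrite f0 //; lia.
  by rewrite f0 //; lia.
split=> //; apply: push_bounded bf (load_is_load t f bf) _ _.
  exact: (z 0 (or_introl isT)).
exact: (z 1 (or_introl isT)).
Qed.

Lemma slideK : rev M (slide t (rev M (slide t f))) = f.
Proof.
have Hu := load_is_load t f (proj2 cf).
have Hr := rev_is_load t M f (load t f) cf slide_config Hu.
have cr := rev_config _ _ slide_config.
have -> : slide t (rev M (slide t f)) = rev M f.
  have e : load t (rev M (slide t f)) = rev M (load t f).
    apply/funext; apply: (is_load_uniq t (rev M (slide t f))) => //.
    exact: load_is_load _ _ (proj2 cr).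
  rewrite {1}/slide e.
  exact: rev_push t M f (load t f) cf Hu.
exact: revK.
Qed.

(** The comparison of masses applies to f and, since the slide of the reflected
image undoes the slide, also to the reflection of slide t f. *)
Lemma stat_slide q : stat q (slide t f) = stat q f.
Proof.
have Hu := load_is_load t f (proj2 cf).
have ca := slide_config; have cr := rev_config _ _ ca.
have h1 := stat_le_rev t q M f (load t f) cf ca Hu.
have Hr := rev_is_load t M f (load t f) cf ca Hu.
have e := rev_push t M f (load t f) cf Hu.
have cfr : config M (push (rev M (slide t f)) (rev M (load t f))).
  by rewrite e; apply: rev_config.
have h2 := stat_le_rev t q M _ _ cr cfr Hr.
move: h1 h2; rewrite e (revK _ _ cf) -/(slide t f) (stat_rev q M _ ca); lia.
Qed.

Lemma total_slide : total (slide t f) = total f.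
Proof. by rewrite -(stat_full M _ slide_config) stat_slide (stat_full M _ cf). Qed.

End Slide.

Lemma slide_inj t M N f g : config M f -> config N g -> f 6 <= t -> g 6 <= t ->
  slide t f = slide t g -> f = g.
Proof.
move=> cf cg ft gt e; pose L := maxn M N.
have cf' : config L f := configW _ _ _ (leq_maxl M N) cf.
have cg' : config L g := configW _ _ _ (leq_maxr M N) cg.
by rewrite -(slideK t L f cf' ft) -(slideK t L g cg' gt) e.
Qed.

(** The preimage is obtained by sliding the reflection. The frame is enlarged
by one because excess may leave the old frame on the right. *)
Lemma slide_surj t M a : config M a ->
  exists f, [/\ config M.+1 f, f 6 <= t & slide t f = a].
Proof.
move=> ca; have ca1 := configW M M.+1 a (leqnSn M) ca.
have cr := rev_config _ _ ca1.
have r6 : rev M.+1 a 6 = 0.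
  by rewrite /rev; case: leqP => // h; apply: (proj1 ca); right; lia.
have r6t : rev M.+1 a 6 <= t by rewrite r6.
have cs := slide_config t _ _ cr r6t.
have g6 : rev M.+1 (slide t (rev M.+1 a)) 6 <= t.
  rewrite {1}/rev; case: leqP => // h.
  have -> : M.+1 - 6 = M - 5 by lia.
  rewrite /slide /push.
  have -> : rev M.+1 a (M - 5).+1 = 0.
    rewrite /rev; case: leqP => // h'; apply: (proj1 ca); left; lia.
  rewrite sub0n addn0.
  have := load_pair_le t _ _ (load_is_load t _ (proj2 cr)) (M - 5); lia.
have cg := rev_config _ _ cs.
exists (rev M.+1 (slide t (rev M.+1 a))); split=> //.
have e := congr1 (rev M.+1) (slideK t _ _ cr r6t).
by rewrite (revK _ _ (slide_config t _ _ cg g6)) (revK _ _ ca1) in e.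
Qed.

(** * Energy *)

(** The degree of the configuration: index 6 is site 0. *)
Definition energy f := total (fun i => (i - 6) * f i).

(** Every unit outside the load moves one site to the left. *)
Lemma energy_slide t M f : config M f -> f 6 <= t ->
  energy f = energy (slide t f) + (total f - stat t f).
Proof.
move=> cf ft; have ca := slide_config t M f cf ft.
have le := load_leq M f cf t.
have e0 i : i <= 6 -> f i - load t f i = 0.
  rewrite leq_eqVlt => /predU1P[->|hi].
    by rewrite (load6 t M f cf ft) subnn.
  by rewrite (proj1 cf) //; left.
have eM : f M.+1 = 0 by apply: (proj1 cf); lia.
have lM : load t f M.+1 = 0 by apply: (load0 M) => //; lia.
rewrite /energy /stat !(totalE M.+1);
  try by move=> i hi; rewrite ?(proj1 cf) ?(proj1 ca) ?(load0 M f cf t) ?muln0 //; lia.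
have -> : \sum_(i < M.+1) f i - \sum_(i < M.+1) load t f i =
    \sum_(i < M.+1) (f i - load t f i).
  by rewrite -sumnB // => i _; apply: le.
pose e i := f i - load t f i.
have -> : \sum_(i < M.+1) (i - 6) * slide t f i =
    \sum_(i < M.+1) (i - 6) * load t f i + \sum_(i < M.+1) (i - 6) * e i.+1.
  by rewrite -big_split /=; apply: eq_bigr => i _; rewrite -mulnDr.
have -> : \sum_(i < M.+1) (i - 6) * f i =
    \sum_(i < M.+1) (i - 6) * load t f i + \sum_(i < M.+1) (i - 6) * e i.
  by rewrite -big_split /=; apply: eq_bigr => i _; rewrite -mulnDr /e subnKC.
rewrite -addnA; congr addn.
have -> : \sum_(i < M.+1) (i - 6) * e i.+1 = \sum_(i < M.+1) (i - 7) * e i.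
  rewrite [LHS]big_ord_recr [RHS]big_ord_recl /= /e eM lM subnn muln0 addn0 add0n.
  by apply: eq_bigr => i _; rewrite /bump /= add1n subSS.
rewrite -big_split /=; apply: eq_bigr => i _.
case: (leqP i 6) => hi; first by rewrite /e e0 // !muln0.
have -> : i - 6 = (i - 7).+1 by lia.
by rewrite mulSn addnC.
Qed.

(** * Configurations that are their own load *)

(** The limits of the load rule of capacity p for f taken as its own load. *)
Definition small p f := forall i, f i + f i.+1 <= p /\
  f i + f i.+1 + f i.+2 + (f i.+1 + f i.+2 + f i.+3) <= p + k.

Lemma smallP p M f : config M f -> (stat p f = total f <-> small p f).
Proof.
move=> cf; have le := load_leq M f cf p.
have [_ [_ H]] := load_is_load p f (proj2 cf).
have [f0 bf] := cf; split=> [|sf].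
  rewrite (statE M _ cf) (total_config M _ cf) => e.
  have /eqP : \sum_(i < M) (f i - load p f i) = 0.
    by rewrite sumnB // e subnn.
  rewrite sum_nat_eq0 => /forallP/= z.
  have {}e i : load p f i = f i.
    case: (ltnP i M) => iM; last by rewrite (load0 M) ?f0 //; lia.
    by have := z (Ordinal iM); have := le i; rewrite /=; lia.
  move=> i; have := H i; rewrite /load_at !e.
  case: i => [|i]; last by have := H i; rewrite /load_at !e; lia.
  by have := f0 0 (or_introl isT); have := f0 1 (or_introl isT); lia.
rewrite /stat; congr total; apply/funext; apply: (is_load_uniq p f).
  exact: load_is_load.
split; first exact: f0 0 (or_introl isT).
split; first exact: f0 1 (or_introl isT).
by move=> i; have := sf i; have := sf i.+1; rewrite /load_at; lia.
Qed.

(** The two sites prepended hold a and 0. *)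
Definition prepend a (h : nat -> nat) i :=
  if i == 6 then a else if i < 8 then 0 else h (i - 2).

Lemma total_prepend a M (h : nat -> nat) :
  (forall i, i < 6 \/ M < i + 6 -> h i = 0) -> total (prepend a h) = a + total h.
Proof.
move=> h0; rewrite (totalE (6 + M) h); last by move=> i hi; apply: h0; lia.
rewrite (totalE (8 + M)); last first.
  by move=> i hi; rewrite /prepend !ifF ?h0 //; lia.
rewrite big_split_ord [in RHS]big_split_ord /=.
have -> : \sum_(i < 8) prepend a h i = a.
  by rewrite /prepend !big_ord_recl big_ord0 /=; lia.
have -> : \sum_(i < 6) h i = 0.
  by rewrite big1 // => i _; apply: h0; left.
by congr addn; rewrite add0n; apply: eq_bigr.
Qed.

Section Insertion.
Variables (p M : nat) (d : nat -> nat).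
Hypotheses (cd : config M d) (sd : small p d) (pk : p <= k) (d6 : d 6 <= k - p).

Let dz i : i < 6 -> d i = 0.
Proof. by move=> hi; apply: (proj1 cd); left. Qed.

(** The frame grows by the two new sites; 12 is large enough to hold the first
site also when M is small. *)
Lemma prepend_config : config (M + 12) (prepend p d).
Proof.
have [d0 bd] := cd; split=> [i hi|i].
  rewrite /prepend; case: eqP => [i6|_]; first by lia.
  by case: ltnP => // h; apply: d0; lia.
have := sd 6; have := bd 6; have := bd i.-2.
by case: i => [|[|[|[|[|[|[|[|i]]]]]]]]; rewrite /prepend /= ?subSS ?subn0 /=; lia.
Qed.

(** Next to the loads of d, the limits that involve the prepended site are
never violated, because d is small for the capacity p and its first site holds
at most k - p. *)
Lemma load_prepend q : load q (prepend p d) = prepend (minn p q) (load q d).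
Proof.
have ci := prepend_config.
apply/funext; apply: (is_load_uniq q (prepend p d)).
  exact: load_is_load _ _ (proj2 ci).
have lz i : i < 6 -> load q d i = 0.
  by move=> hi; apply: (load0 M) => //; left.
have [_ [_ H]] := load_is_load q d (proj2 cd).
have le := load_leq M d cd q.
split=> //; split=> // i.
have := sd 6; have := H 4; have := H 5; have := H i.-2; have := le 6.
have := lz 4 isT; have := lz 5 isT; have := dz 5 isT.
by case: i => [|[|[|[|[|[|[|[|i]]]]]]]]; rewrite /load_at /prepend /= ?subSS ?subn0 /=; lia.
Qed.

Lemma stat_prepend q : stat q (prepend p d) = minn p q + stat q d.
Proof.
by rewrite /stat load_prepend (total_prepend _ M) // => i; apply: (load0 M).
Qed.

Lemma total_ins_config : total (prepend p d) = p + total d.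
Proof. exact: total_prepend (proj1 cd). Qed.

Lemma energy_prepend : energy (prepend p d) = energy d + 2 * total d.
Proof.
have [d0 bd] := cd.
have -> : energy (prepend p d) = total (prepend 0 (fun i => (i - 4) * d i)).
  rewrite /energy; congr total; apply/funext => i; rewrite /prepend.
  case: eqP => [->//|_]; case: ltnP => // i8; first by rewrite muln0.
  congr muln; lia.
rewrite (total_prepend _ M) => [|i /d0 ->]; last by rewrite muln0.
rewrite add0n /energy !(totalE M);
  try by move=> i hi; rewrite d0 ?muln0 //; lia.
rewrite big_distrr -big_split /=; apply: eq_bigr => i _.
rewrite -mulnDl; case: (ltnP i 6) => hi; first by rewrite dz ?muln0.
congr muln; lia.
Qed.

End Insertion.

(** Deletion of the first two sites, the inverse of [prepend] on small
configurations whose first site holds p. *)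
Definition chop f i := if i < 6 then 0 else f i.+2.

Lemma chop_config M f : config M f -> config M (chop f).
Proof.
move=> [f0 bf]; split=> [i hi|i]; rewrite /chop.
  by case: ltnP => // h; apply: f0; lia.
have := bf i.+2; case: (ltnP i 6); case: (ltnP i.+1 6); case: (ltnP i.+2 6); lia.
Qed.

Lemma chop_small p f : small p f -> small p (chop f).
Proof.
move=> sf i; have := sf i.+2; rewrite /chop.
by do 4 (case: ifP => _); lia.
Qed.

Section Removal.
Variables (p M : nat) (f : nat -> nat).
Hypotheses (cf : config M f) (sf : small p f) (f6 : f 6 = p).

Lemma chop7 : f 7 = 0.
Proof. by have := sf 6; rewrite f6; lia. Qed.

Lemma chopK : prepend p (chop f) = f.
Proof.
apply/funext => i; rewrite /prepend /chop; case: eqP => [->//|i6].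
case: ltnP => i8.
  case: (i =P 7) => [->|i7]; first by rewrite chop7.
  by rewrite (proj1 cf) //; left; lia.
by rewrite ifF; [congr f; lia | lia].
Qed.

Lemma chop6 : chop f 6 <= k - p.
Proof. by rewrite /chop /=; have := proj2 cf 6; rewrite f6 chop7; lia. Qed.

Lemma small_head_le : p <= k.
Proof. by have := proj2 cf 6; rewrite f6; lia. Qed.

End Removal.

Lemma slide_stat_config t M f : config M f -> f 6 <= t ->
  config M (slide t f) /\ forall q, stat q (slide t f) = stat q f.
Proof.
move=> cf ft; split; first exact: slide_config.
by move=> q; apply: (stat_slide t M).
Qed.

(** * Particle content *)

Section Content.
Implicit Type m : {ffun 'I_k -> nat}.

(** The index l stands for the size l + 1: a particle of size l + 1 contributes
min(q, l + 1) to the mass of the load of capacity q. *)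
Definition content_stat m q := \sum_(l < k) minn q l.+1 * m l.

Definition has_content m f :=
  (exists M, config M f) /\ forall q, q <= k -> stat q f = content_stat m q.

Definition add_particle m (l : 'I_k) : {ffun 'I_k -> nat} :=
  [ffun i => m i + (i == l)].

Lemma sum_add_particle m l (F : 'I_k -> nat) :
  \sum_i F i * add_particle m l i = \sum_i F i * m i + F l.
Proof.
rewrite (bigD1 l) //= [in RHS](bigD1 l) //= ffunE eqxx mulnDr muln1 addnAC.
do 2 congr addn; apply: eq_bigr => i /negPf il.
by rewrite ffunE il addn0.
Qed.

Lemma content_stat_add m l q :
  content_stat (add_particle m l) q = content_stat m q + minn q l.+1.
Proof. exact: sum_add_particle. Qed.

Lemma stat0 M f : config M f -> stat 0 f = 0.
Proof.
move=> cf; rewrite (statE M _ cf) big1 // => i _.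
by have := load_pair_le 0 _ _ (load_is_load 0 f (proj2 cf)) i; lia.
Qed.

Lemma content_total m f : has_content m f -> total f = content_stat m k.
Proof. by case=> -[M cf] H; rewrite -H // (stat_full M). Qed.

Lemma content_slide t m f : has_content m f -> f 6 <= t ->
  has_content m (slide t f).
Proof.
move=> [[M cf] H] ft; have [cs e] := slide_stat_config t M f cf ft.
by split; [exists M | move=> q qk; rewrite e H].
Qed.

Lemma content_unslide t m f : (exists M, config M f) -> f 6 <= t ->
  has_content m (slide t f) -> has_content m f.
Proof.
move=> [M cf] ft [_ H]; have [_ e] := slide_stat_config t M f cf ft.
by split; [exists M | move=> q qk; rewrite -e H].
Qed.

(** Let p be the least capacity whose load is all of f. If the first site holds
less than p, the slide of capacity p - 1 lowers the energy and keeps all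
masses. Otherwise it holds p; deleting the first two sites and sliding with
capacity k - p lowers the total mass and removes one particle of size p. *)
Lemma content_exists M f : config M f -> exists m, has_content m f.
Proof.
move: {2}(total f + energy f).+1 (ltnSn (total f + energy f)) => n.
elim: n M f => // n IHn M f; rewrite ltnS => len cf.
have [t0|tpos] := posnP (total f).
  exists [ffun=> 0]; split; first by exists M.
  move=> q _; rewrite /content_stat big1 => [|l _]; last by rewrite ffunE muln0.
  by have := stat_le_total M f cf q; rewrite t0; lia.
have ex : exists p, stat p f == total f by exists k; rewrite (stat_full M f cf).
have [[|p] /eqP ep minp] := ex_minnP ex.
  by move: ep tpos; rewrite (stat0 M f cf) => <-.
have sf : small p.+1 f by apply/(smallP _ M f cf).
have ltp : stat p f < total f.
  rewrite ltn_neqAle (stat_le_total M f cf) andbT.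
  by apply/negP => /minp; rewrite ltnn.
case: (leqP (f 6) p) => f6.
  have [cs e] := slide_stat_config p M f cf f6.
  have en := energy_slide p M f cf f6.
  have tt := total_slide p M f cf f6.
  have [|m hm] := IHn M (slide p f) _ cs; first by lia.
  by exists m; apply: (content_unslide p) => //; exists M.
have {}f6 : f 6 = p.+1 by have := sf 6; lia.
have pk : p < k := small_head_le _ M f cf f6.
have fK := chopK _ M f cf sf f6.
have cr := chop_config M f cf.
have r6 := chop6 _ M f cf sf f6.
have sr := chop_small _ _ sf.
have [cs e] := slide_stat_config _ M _ cr r6.
have en := energy_slide _ M _ cr r6.
have tt := total_slide _ M _ cr r6.
have ti := total_ins_config p.+1 M _ cr.
have ei := energy_prepend p.+1 M _ cr pk r6.
rewrite fK in ti ei.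
have [|m [_ hm]] := IHn M (slide (k - p.+1) (chop f)) _ cs; first by lia.
exists (add_particle m (Ordinal pk)); split; first by exists M.
move=> q qk; rewrite content_stat_add -hm // e -[in LHS]fK.
by rewrite (stat_prepend _ M _ cr sr pk r6) addnC minnC.
Qed.

Lemma content_statS m q :
  content_stat m q.+1 = content_stat m q + \sum_(l < k | q <= l) m l.
Proof.
rewrite /content_stat [X in _ = _ + X]big_mkcond -big_split /=.
apply: eq_bigr => l _; case: leqP => ql; last first.
  by rewrite addn0; congr muln; lia.
by rewrite -[X in _ + X]mul1n -mulnDl; congr muln; lia.
Qed.

(** The second differences of content_stat m in q give back m, up to sign. *)
Lemma content_unique m m' f : has_content m f -> has_content m' f -> m = m'.
Proof.
move=> [_ H] [_ H'].
have eN q : q <= k -> \sum_(l < k | q <= l) m l = \sum_(l < k | q <= l) m' l.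
  rewrite leq_eqVlt => /predU1P[->|qk].
    by rewrite !big1 // => l; have := ltn_ord l; lia.
  have := content_statS m q; have := content_statS m' q.
  rewrite -!H -?H' ?(ltnW qk) //; lia.
apply/ffunP => l; have lk := ltn_ord l.
have top (F : {ffun 'I_k -> nat}) :
    \sum_(i < k | l <= i) F i = F l + \sum_(i < k | l < i) F i.
  rewrite (bigD1 l) //=; congr addn.
  by apply: eq_bigl => i; rewrite -val_eqE /=; lia.
by have := eN l (ltnW lk); rewrite !top (eN l.+1 lk); apply: addIn.
Qed.

Lemma content_stat_top m (l : 'I_k) : (forall i : 'I_k, l < i -> m i = 0) ->
  content_stat m k = content_stat m l.+1 /\
  content_stat m l.+1 = content_stat m l + m l.
Proof.
move=> m0; split.
  apply: eq_bigr => i _; case: (leqP i l) => il; last by rewrite m0 // !muln0.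
  by congr muln; have := ltn_ord i; have := ltn_ord l; lia.
rewrite content_statS (bigD1 l) //= big1 ?addn0 // => i /andP[li il].
by apply: m0; move: il; rewrite -val_eqE /=; lia.
Qed.

(** No particle is larger than l + 1, so the load of capacity l + 1 is all of
f, and the load of capacity l misses one unit from each particle of that size. *)
Lemma content_top m (l : 'I_k) (ml : forall i : 'I_k, l < i -> m i = 0) f :
  has_content m f ->
  [/\ small l.+1 f, f 6 <= l.+1 & total f = stat l f + m l].
Proof.
move=> hm; have [[M cf] H] := hm; have lk := ltn_ord l.
have [e1 e2] := content_stat_top m l ml.
have sf : small l.+1 f.
  by apply/(smallP _ M f cf); rewrite H // (content_total m f hm).
split=> //; first by have := sf 6; lia.
by rewrite H ?(ltnW lk) // (content_total m f hm) e1.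
Qed.

(** The energy lost when a particle of size l + 1 at the first site is deleted:
two for every unit of mass behind it, which moves by two sites, and then the
mass outside the load of capacity k - l - 1, which moves by one more site. *)
Definition lead_weight m (l : 'I_k) :=
  3 * content_stat m k - content_stat m (k - l.+1).

(** * Adding a particle of largest size *)

Section Recursion.
Variables (m : {ffun 'I_k -> nat}) (l : 'I_k).
Hypothesis ml : forall i : 'I_k, l < i -> m i = 0.

Let ml1 (i : 'I_k) : l < i -> add_particle m l i = 0.
Proof.
move=> li; rewrite ffunE ml // (_ : (i == l) = false) //.
by apply/negbTE; rewrite -val_eqE /=; lia.
Qed.

Local Notation S := [set f | has_content m f]%classic.
Local Notation S1 := [set f | has_content (add_particle m l) f]%classic.
Local Notation low := [set f : nat -> nat | f 6 <= l]%classic.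

Lemma energy_low f : S1 f -> low f ->
  energy f = energy (slide l f) + (m l).+1.
Proof.
move=> hm f6; have [[M cf] _] := hm.
rewrite (energy_slide l M f cf f6).
have [_ _ ->] := content_top _ _ ml1 f hm.
by rewrite addKn ffunE eqxx addn1.
Qed.

Lemma slide_low_bij : set_bij (S1 `&` low)%classic S1 (slide l).
Proof.
split=> [f [hf f6] | f g | g hg].
- exact: content_slide.
- rewrite !inE => -[[[M cf] _] f6] [[[N cg] _] g6].
  exact: (slide_inj l M N f g cf cg f6 g6).
- have [[M cg] _] := hg.
  have [f [cf f6 e]] := slide_surj l M g cg.
  exists f => //; split=> //; apply: (content_unslide l) => //; last by rewrite e.
  by exists M.+1.
Qed.

Let strip f := slide (k - l.+1) (chop f).

Lemma strip_bij : set_bij (S1 `&` ~` low)%classic S strip.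
Proof.
have lk := ltn_ord l.
have high f : S1 f -> ~ low f ->
    exists M, [/\ config M f, small l.+1 f & f 6 = l.+1].
  move=> hf /= /negP; rewrite -ltnNge => f6.
  have [sf le6 _] := content_top _ _ ml1 f hf; have [[M cf] _] := hf.
  by exists M; split=> //; apply/eqP; rewrite eqn_leq le6.
split=> [f [hf /high [//|M [cf sf f6]]] | f g | g [[M cg] hg]].
- have r6 := chop6 _ M f cf sf f6; have cr := chop_config M f cf.
  have [cs e] := slide_stat_config _ M _ cr r6.
  split; first by exists M.
  move=> q qk; rewrite e; have [_ /(_ q qk)] := hf.
  rewrite -[in LHS](chopK _ M f cf sf f6).
  rewrite (stat_prepend _ M _ cr (chop_small _ _ sf) lk r6) content_stat_add minnC.
  lia.
- rewrite !inE => -[hf /high [//|M [cf sf f6]]] [hg /high [//|N [cg sg g6]]] e.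
  rewrite -(chopK _ M f cf sf f6) -(chopK _ N g cg sg g6); congr prepend.
  apply: (slide_inj (k - l.+1) M N) e; try exact: chop_config.
    exact: (chop6 _ M).
  exact: (chop6 _ N).
- have [d [cd d6 e]] := slide_surj (k - l.+1) M g cg.
  have [_ es] := slide_stat_config _ _ _ cd d6; rewrite e in es.
  have [e1 _] := content_stat_top m l ml.
  have sd : small l.+1 d.
    apply/(smallP _ _ _ cd); rewrite -es hg // -(stat_full _ _ cd) -es hg //.
  have ci := prepend_config l.+1 _ d cd sd lk d6.
  exists (prepend l.+1 d); last first.
    rewrite -[RHS]e /strip; congr slide; apply/funext => i; rewrite /chop.
    case: ltnP => i6; first by rewrite (proj1 cd) //; left.
    by rewrite /prepend !ifF ?subSS ?subn0 //; lia.
  split; last by rewrite /= /prepend /= ltnn.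
  split; first by exists (M.+1 + 12).
  move=> q qk; rewrite (stat_prepend _ _ _ cd sd lk d6) content_stat_add -hg //.
  by rewrite -es addnC minnC.
Qed.

Lemma energy_high f : S1 f -> ~ low f ->
  energy f = energy (strip f) + lead_weight m l.
Proof.
have lk := ltn_ord l.
move=> hf nl; have hs : S (strip f) by have [H _ _] := strip_bij; apply: H.
have f6 : l < f 6 by rewrite ltnNge; apply/negP.
have [sf le6 _] := content_top _ _ ml1 f hf; have [[M cf] _] := hf.
have {le6}f6 : f 6 = l.+1 by lia.
have cr := chop_config M f cf; have r6 := chop6 _ M f cf sf f6.
have tr := content_total m _ hs; have [_ sr] := hs.
rewrite (total_slide _ M _ cr r6) in tr.
have {}sr := sr (k - l.+1) (leq_subr _ _).
rewrite (stat_slide _ M _ cr r6) in sr.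
have le := stat_le_total M _ cr (k - l.+1).
rewrite -[in LHS](chopK _ M f cf sf f6) (energy_prepend _ M _ cr lk r6).
rewrite (energy_slide _ M _ cr r6) -/(strip f) /lead_weight -tr -sr; lia.
Qed.

End Recursion.

End Content.

End Carrier.

Local Open Scope classical_set_scope.
Local Open Scope ring_scope.

(** * Generating series *)

Section GeneratingSeries.
Implicit Types (I J : choiceType).

Definition genseries I (D : set I) (e : I -> nat) : fps int :=
  fps_sum D (fun i => fpsX int ^+ e i).

Lemma genseries_coef I (D : set I) (e : I -> nat) n :
  genseries I D e n = \sum_(i \in D `&` [set i | e i = n]) (1 : int).
Proof.
rewrite /=; under eq_fsbigr => i _ do rewrite fps_coefXn.
rewrite -(fsbig_widen (D `&` [set i | e i = n]) D); last 2 first.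
- by move=> i [].
- move=> i [Di /= H]; case: eqP => // en; case: H; split=> //.
by apply: eq_fsbigr => i; rewrite inE => -[_ /= ->]; rewrite eqxx.
Qed.

Lemma fps_coefXnM a (G : fps int) n :
  (fpsX int ^+ a * G) n = if (n < a)%N then 0 else G (n - a)%N.
Proof.
rewrite fps_coefM; case: ltnP => an.
  rewrite big1 // => i _; have := ltn_ord i => ia.
  by rewrite fps_coefXn (_ : (_ == a) = false) ?mul0r //; apply/eqP; lia.
rewrite (bigD1 (Ordinal (an : a < n.+1)%N)) //= fps_coefXn eqxx mul1r.
rewrite big1 ?addr0 // => i; rewrite -val_eqE /= fps_coefXn => /negbTE ->.
by rewrite mul0r.
Qed.

Lemma genseries_bij I J (D : set I) (D' : set J) e e' h a : set_bij D D' h ->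
  (forall i, D i -> e i = (e' (h i) + a)%N) ->
  genseries I D e = fpsX int ^+ a * genseries J D' e'.
Proof.
move=> bh eh; apply: fpsP => n; rewrite fps_coefXnM !genseries_coef.
case: ltnP => an.
  rewrite (_ : D `&` _ = set0) ?fsbig_set0 // -subset0 => i [Di /= ei].
  by have := eh i Di; lia.
apply/esym/reindex_fsbig; case: bh => h1 h2 h3; split.
- by move=> i [Di /= ei]; split=> /=; [apply: h1 | have := eh i Di; lia].
- move=> i j; rewrite !inE => -[Di _] [Dj _]; apply: h2; exact/mem_set.
- move=> j [Dj /= ej]; have [i Di hi] := h3 j Dj; exists i => //; split=> //=.
  by rewrite eh // hi ej subnK.
Qed.

Lemma genseries_split I (D B : set I) e :
  (forall n, finite_set (D `&` [set i | e i = n])) ->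
  genseries I D e = genseries I (D `&` B) e + genseries I (D `&` ~` B) e.
Proof.
move=> fD; apply: fpsP => n; rewrite fps_coefD !genseries_coef.
by rewrite (setIAC D B) (setIAC D (~` B)); exact: fsbigID.
Qed.

End GeneratingSeries.

Local Notation configs k := [set f | exists M, config k M f].

Section Characters.
Variable k : nat.
Implicit Type m : {ffun 'I_k -> nat}.

Lemma energy_ge M f i : config k M f -> ((i - 6) * f i <= energy f)%N.
Proof.
move=> [f0 _]; rewrite /energy (totalE (M + i.+1)); last first.
  by move=> j hj; rewrite f0 ?muln0 //; lia.
have im : (i < M + i.+1)%N by lia.
by rewrite (bigD1 (Ordinal im)) //= leq_addr.
Qed.

(** A configuration of energy n is empty beyond site n, and no site holds more
than k. *)
Lemma finite_energy n :
  finite_set (configs k `&` [set f | energy f = n]).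
Proof.
pose h (g : {ffun 'I_(n + 7) -> 'I_k.+1}) i :=
  if insub i is Some j then nat_of_ord (g j) else 0%N.
apply: (@sub_finite_set _ _ (h @` setT)).
  move=> f [[M cf] /= en]; exists [ffun j => inord (f (nat_of_ord j))] => //.
  apply/funext => i; rewrite /h; case: insubP => [j _ <-|].
    rewrite ffunE inordK // ltnS.
    by have := proj2 cf j; lia.
  rewrite -leqNgt => ni; have := energy_ge M f i cf; rewrite en.
  case: (f i) => // x; nia.
exact/finite_image/finite_finset.
Qed.

Lemma finite_content m n :
  finite_set ([set f | has_content k m f] `&` [set f | energy f = n]).
Proof. by apply: sub_finite_set (finite_energy n) => f [[]]. Qed.

Definition character m := genseries _ [set f | has_content k m f] energy.

(** The class of m plus one particle of size l + 1 is split by whether the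
first site holds at most l; the first part reproduces the whole class and the
second the class of m. *)
Lemma characterS m (l : 'I_k) : (forall i : 'I_k, (l < i)%N -> m i = 0%N) ->
  (1 - fpsX int ^+ (m l).+1) * character (add_particle k m l) =
  fpsX int ^+ lead_weight k m l * character m.
Proof.
move=> ml; rewrite mulrBl mul1r {1}/character.
rewrite (genseries_split _ _ [set f | f 6 <= l]%N); last exact: finite_content.
rewrite (genseries_bij _ _ _ _ _ energy _ _ (slide_low_bij k m l)
  (fun f H => energy_low k m l ml f (proj1 H) (proj2 H))).
rewrite (genseries_bij _ _ _ _ _ energy _ _ (strip_bij k m l ml)
  (fun f H => energy_high k m l ml f (proj1 H) (proj2 H))).
by rewrite /character addrAC subrr add0r.
Qed.

(** The increment of Q is the row of A of the size l of the new particle, applied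
to m. For a size l' <= l the entry is A_(l,l') = 3 l' - min(k - l, l'), which is
the weight found from the energies. *)
Lemma quadQ_add m (l : 'I_k) : (forall i : 'I_k, (l < i)%N -> m i = 0%N) ->
  quadQ (add_particle k m l) = (quadQ m + lead_weight k m l)%N.
Proof.
move=> ml; pose A (i j : 'I_k) := matA k i.+1 j.+1.
pose w := (\sum_(j < k) A l j * m j)%N.
have -> : lead_weight k m l = w.
  rewrite /lead_weight /content_stat big_distrr /= -sumnB; last first.
    by move=> i _; have := ltn_ord i; nia.
  apply: eq_bigr => j _; case: (leqP j l) => jl; last by rewrite ml // !muln0.
  rewrite mulnA -mulnBl; congr muln.
  by rewrite /A /matA; have := ltn_ord l; lia.
pose m1 := add_particle k m l.
have eT : (\sum_i A i i * m1 i = \sum_i A i i * m i + A l l)%N.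
  exact: sum_add_particle.
have eS : (\sum_i \sum_j A i j * m1 i * m1 j =
    \sum_i \sum_j A i j * m i * m j + w + (w + A l l))%N.
  under eq_bigr => i _ do rewrite sum_add_particle.
  rewrite big_split sum_add_particle /=; congr (_ + (_ + _))%N; last first.
    by apply: eq_bigr => i _; rewrite /A matAC.
  pose B (i : 'I_k) := (\sum_j A i j * m j)%N.
  have BE (n : {ffun 'I_k -> nat}) :
      (\sum_i \sum_j A i j * n i * m j = \sum_i B i * n i)%N.
    apply: eq_bigr => i _; rewrite big_distrl /=.
    by apply: eq_bigr => j _; rewrite mulnAC.
  by rewrite !BE sum_add_particle.
have le : (\sum_i A i i * m i <= \sum_i \sum_j A i j * m i * m j)%N.
  apply: leq_sum => i _; rewrite (bigD1 i) //=; apply: leq_trans (leq_addr _ _).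
  by case: (m i) => [|x]; rewrite ?muln0 // leq_pmulr.
rewrite /quadQ -/m1 eT eS -/(A _ _).
move: le; set S := (\sum_i \sum_j _)%N; set T := (\sum_i _)%N => le.
have -> : (S + w + (w + A l l) - (T + A l l) = w.*2 + (S - T))%N by lia.
by rewrite halfD odd_double /= add0n doubleK addnC.
Qed.

Lemma qpochhammerS n :
  qpochhammer n.+1 = qpochhammer n * (1 - fpsX int ^+ n.+1).
Proof. by rewrite /qpochhammer big_nat_recr. Qed.

Lemma prod_qpochhammer_unit m :
  \prod_(l < k) qpochhammer (m l) \is a GRing.unit.
Proof. by apply: rpred_prod => l _; apply: qpochhammer_unit. Qed.

(** Induction on the number of particles, removing one of the largest size. *)
Lemma characterE m :
  character m = fpsX int ^+ quadQ m / \prod_(l < k) qpochhammer (m l).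
Proof.
have [n] := ubnP (\sum_l m l)%N; elim: n m => // n IHn m; rewrite ltnS => lem.
have unit1 := prod_qpochhammer_unit.
have [m0|] := boolP [forall l, m l == 0%N].
  have {}m0 l : m l = 0%N by apply/eqP/(forallP m0).
  rewrite big1 => [|l _]; last by rewrite m0 /qpochhammer big_geq.
  have -> : quadQ m = 0%N.
    rewrite /quadQ big1 // => i _; rewrite big1 // => j _.
    by rewrite m0 muln0.
  rewrite divr1 expr0.
  have f0 : has_content k m (fun=> 0%N).
    have c0 : config k 0 (fun=> 0%N) by split.
    split; first by exists 0%N.
    move=> q _; rewrite /content_stat big1 => [|i _]; last by rewrite m0 muln0.
    have := stat_le_total k 0 _ c0 q.
    by rewrite (total_config k 0 _ c0) big_ord0; lia.
  have m0' : character m = genseries _ [set (fun=> 0%N)] energy.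
    rewrite /character; congr genseries.
    rewrite eqEsubset; split=> f; last by move=> ->.
    move=> hf; have := content_total k m f hf; have [[M cf] _] := hf.
    rewrite /content_stat [in X in _ = X -> _]big1 => [|i _]; last first.
      by rewrite m0 muln0.
    rewrite (total_config k M f cf) => /eqP; rewrite sum_nat_eq0 => /forallP /= z.
    apply/funext => i; case: (ltnP i M) => iM.
      by apply/eqP; apply: (z (Ordinal iM)).
    by apply: (proj1 cf); lia.
  rewrite m0'; apply: fpsP => i; rewrite /genseries /= fsbig_set1.
  have -> : energy (fun=> 0%N) = 0%N.
    by rewrite /energy (totalE 0) ?big_ord0 // => j _; rewrite muln0.
  by rewrite fps_coefXn.
move=> /forallPn /= [l0 nz].
have [l lP lmax] := arg_maxnP (fun i : 'I_k => nat_of_ord i)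
  (nz : (fun i => m i != 0%N) l0).
have {}lP : (0 < m l)%N by rewrite lt0n.
pose m' : {ffun 'I_k -> nat} := [ffun i => (m i - (i == l))%N].
have mE : m = add_particle k m' l.
  apply/ffunP => i; rewrite /add_particle /m' !ffunE.
  by have [->|_] := eqVneq i l; rewrite ?subnK // subn0 addn0.
have ml' (i : 'I_k) : (l < i)%N -> m' i = 0%N.
  move=> li; rewrite ffunE; have := lmax i; rewrite /=.
  by case: (m i) => // x /(_ isT); lia.
have lem' : (\sum_l m' l < n)%N.
  have /= := sum_add_particle k m' l (fun=> 1%N).
  by rewrite -mE -!big_distrr /= !mul1n addn1 => e; move: lem; rewrite e.
have pE : \prod_(i < k) qpochhammer (m i) =
    (1 - fpsX int ^+ (m' l).+1) * \prod_(i < k) qpochhammer (m' i).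
  rewrite (bigD1 l) //= [in RHS](bigD1 l) //= mulrA {1}mE ffunE eqxx addn1.
  rewrite qpochhammerS; congr (_ * _); first exact: mulrC.
  by apply: eq_bigr => i /negPf il; rewrite mE ffunE il addn0.
apply: (mulIr (unit1 m)); rewrite divrK // pE mulrA [character m * _]mulrC.
rewrite {1}mE characterS // IHn // -mulrA divrK // -exprD mE quadQ_add //.
by rewrite addnC.
Qed.

End Characters.

(** * Summation over all contents *)

Section Assembly.
Variable k : nat.
Implicit Type m : {ffun 'I_k -> nat}.

Definition pad (a : nat -> nat) (i : nat) : nat :=
  if (i < 6)%N then 0%N else a (i - 6)%N.

Definition unpad (f : nat -> nat) (i : nat) : nat := f (i + 6)%N.

Lemma padK : cancel pad unpad.
Proof.
move=> a; apply/funext => i; rewrite /unpad /pad addnK.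
by rewrite ltnNge leq_addl.
Qed.

Lemma pad_bij : set_bij (admissible k) (configs k) pad.
Proof.
split=> [a [[N aN] ab] | a b _ _ | f [M [f0 fb]]].
- exists (N + 12)%N; split=> [i hi | i]; rewrite /pad.
    by case: ltnP => // i6; apply: aN; lia.
  have := ab 0%N; have := ab (i - 6)%N.
  by case: i => [|[|[|[|[|[|i]]]]]]; rewrite /= ?subSS ?subn0; lia.
- exact: (can_inj padK).
- exists (unpad f); last first.
    apply/funext => i; rewrite /pad /unpad; case: ltnP => i6.
      by rewrite f0 //; left.
    by rewrite subnK.
  split; first by exists M => i hi; apply: f0; lia.
  by move=> i; exact: fb.
Qed.

Lemma degree_pad a : admissible k a -> degree a = energy (pad a).
Proof.
move=> [[N aN] _]; transitivity (\sum_(i < N) i * a i)%N.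
  by apply: (totalE N) => i hi; rewrite aN ?muln0.
rewrite /energy (totalE (6 + N)%N); last first.
  by move=> i hi; rewrite /pad ifF ?aN ?muln0 //; lia.
rewrite big_split_ord /= [X in (_ = X + _)%N]big1 ?add0n => [|i _].
  by apply: eq_bigr => i _; rewrite /pad addKn ltnNge leq_addr.
by rewrite /pad ltn_ord muln0.
Qed.

Definition content (f : nat -> nat) : {ffun 'I_k -> nat} :=
  xget [ffun=> 0%N] [set m | has_content k m f].

Lemma contentP M f m : config k M f -> (content f = m <-> has_content k m f).
Proof.
move=> cf; have [m0 hm0] := content_exists k M f cf.
have hc : has_content k (content f) f :=
  @xgetPex _ _ [set m' | has_content k m' f] (ex_intro _ m0 hm0).
by split=> [<- //|]; apply: content_unique.
Qed.

Lemma has_contentE n m :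
  [set f | has_content k m f] `&` [set f | energy f = n] =
  (configs k `&` [set f | energy f = n]) `&`
  [set f | content f = m].
Proof.
rewrite eqEsubset; split=> f.
  by move=> [hm /= en]; have [[M cf] _] := hm; split;
    [split=> //; exists M | apply/(contentP M)].
by move=> [[[M cf] /= en] /(contentP M) H]; split=> //; apply: H.
Qed.

Lemma character_coef0 m n :
  ~ (content @` (configs k `&` [set f | energy f = n])) m ->
  character k m n = 0.
Proof.
move=> nm; rewrite genseries_coef has_contentE.
rewrite (_ : _ `&` _ = set0) ?fsbig_set0 // -subset0 => f [hf fm].
by apply: nm; exists f.
Qed.

(** In each degree only finitely many configurations, hence finitely many
contents, occur, and every configuration has exactly one content. *)
Lemma genseries_configurations :
  genseries _ (configs k) energy =
  fps_sum [set: {ffun 'I_k -> nat}] (character k).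
Proof.
apply: fpsP => n; rewrite genseries_coef.
transitivity (\sum_(m \in [set: {ffun 'I_k -> nat}]) character k m n); last first.
  by [].
set C := _ `&` _; have fC : finite_set C := finite_energy k n.
rewrite -(fsbig_widen (content @` C) setT) //; last first.
  by move=> m [_ /= nm]; apply: character_coef0.
transitivity (\sum_(m \in content @` C)
    \sum_(f \in C) (if f \in [set f | content f = m] then 1 else 0 : int));
    last first.
  apply: eq_fsbigr => m _.
  rewrite /character genseries_coef has_contentE -/C.
  exact/esym/fsbig_mkcondr.
rewrite exchange_fsbig //; last exact: finite_image.
apply: eq_fsbigr => f; rewrite inE => Cf.
rewrite -(fsbig_widen [set content f] (content @` C)).
- by rewrite fsbig_set1 ifT //; apply/mem_set.
- by move=> m ->; exists f.
- by move=> m [_ /= nm]; rewrite ifF //; apply/negbTE/negP; rewrite inE => /esym.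
Qed.

End Assembly.

Theorem mainTheorem3 (k : nat) :
  [/\ fps_summable (admissible k)
        (fun a : nat -> nat => fpsX int ^+ degree a),
      fps_summable [set: {ffun 'I_k -> nat}]
        (fun m => fpsX int ^+ quadQ m / \prod_(l < k) qpochhammer (m l))
    & fps_sum (admissible k)
        (fun a : nat -> nat => fpsX int ^+ degree a) =
      fps_sum [set: {ffun 'I_k -> nat}]
        (fun m => fpsX int ^+ quadQ m / \prod_(l < k) qpochhammer (m l))].
Proof.
rewrite (_ : (fun m : {ffun 'I_k -> nat} => _) = character k); last first.
  by apply/funext => m; rewrite characterE.
have [padC _ _] := pad_bij k.
split=> [n | n | ].
- apply: (@sub_finite_set _ _ (unpad @` (configs k `&`
    [set f | energy f = n]))); last exact/finite_image/finite_energy.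
  move=> a [Aa]; rewrite fps_coefXn.
  case: (n =P degree a) => [en _|_]; last by rewrite eqxx.
  exists (pad a); last exact: padK.
  split; [exact: padC | by rewrite /= -(degree_pad k a Aa) en].
- apply: (@sub_finite_set _ _ (content k @` (configs k `&`
    [set f | energy f = n]))); last exact/finite_image/finite_energy.
  move=> m [_ nz]; apply: contrapT => nm.
  by rewrite character_coef0 ?eqxx in nz.
- rewrite -genseries_configurations -[RHS]mul1r -(expr0 (fpsX int)).
  apply: genseries_bij (pad_bij k) _ => a Aa.
  by rewrite addn0 (degree_pad k).
Qed.
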